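(* For every economy $\Gamma=(I,O,\succ_I,\{C_o\}_{o\in O})$, the rectified core of $\Gamma$ is nonempty.
   Context: **Economies.** An economy is a tuple $\Gamma=(I,O,\succ_I,\{C_o\}_{o\in O})$, where $I$ is a finite set of agents, $O$ is a finite set of indivisible objects, each agent $i\in I$ demands at most one object and has a strict preference given by a linear order $\succ_i$ on $O\cup\{o^*\}$ ($o^*\notin O$ is a null object), and each object $o$ is owned by a nonempty set $C_o\subseteq I$ of agents. Write $a\succsim_i b$ if $a=b$ or $a\succ_i b$. A coalition is a nonempty subset of $I$. The endowments of a coalition $C$ are $\omega(C)=\{o\in O: C_o\subseteq C\}$. **Allocations.** An allocation is a map $\mu:I\to O\cup\{o^*\}$ such that each $o\in O$ is assigned to at most one agent ($|\mu^{-1}(o)|\le 1$); any number of agents may be assigned $o^*$. For a coalition $C$, $\mu(C)=\{\mu(i):i\in C\}$. **Self-enforcing.** A coalition $C$ is self-enforcing in an allocation $\sigma$ if $\sigma(C)\subseteq\omega(C)\cup\{o^*\}$. For a coalition $C$ and allocations $\mu,\sigma$, let $C_{\sigma=\mu}=\{i\in C:\sigma(i)=\mu(i)\}$. **Rectified core.** An allocation $\mu$ is rectification blocked by a coalition $C$ via another allocation $\sigma$ if: 1. $\sigma(i)\succsim_i\mu(i)$ for all $i\in C$, and $\sigma(j)\succ_j\mu(j)$ for some $j\in C$; 2. $\sigma(C)\subseteq\omega(C)\cup\{o^*\}$; 3. for every coalition $C'\subseteq C_{\sigma=\mu}$ that is self-enforcing in $\sigma$ and every $i\in C\setminus C'$: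 $\sigma(i)\in\omega(C')$ implies $\sigma(i)\notin\mu(I\setminus C)$. The rectified core is the set of allocations that are not rectification blocked (by any coalition via any allocation). *)

(* Defs.v *)
(* Plain MathComp. *)
From HB Require Import structures.
From mathcomp Require Import all_boot.

Set Implicit Arguments.
Unset Strict Implicit.
Unset Printing Implicit Defensive.

(* The null object o^* is [None : option O]; an object [o : O] is [Some o].
   [prefers E i] is the strict linear order of agent i, with
   [prefers E i a b] meaning that i strictly prefers a to b. *)
Record economy (I O : finType) := Economy {
  prefers : I -> rel (option O);
  owners : O -> {set I};
  prefers_irr : forall i, irreflexive (prefers i);
  prefers_trans : forall i, transitive (prefers i);
  prefers_total : forall i a b, a != b -> prefers i a b || prefers i b a;
  owners_neq0 : forall o, owners o != set0
}.

Definition is_allocation (I O : finType) (mu : {ffun I -> option O}) : bool :=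
  [forall o : O, #|[set i | mu i == Some o]| <= 1].

Record allocation (I O : finType) := Allocation {
  alloc_fun :> {ffun I -> option O};
  allocP : is_allocation alloc_fun
}.

HB.instance Definition _ (I O : finType) := [isSub for @alloc_fun I O].
HB.instance Definition _ (I O : finType) := [Countable of allocation I O by <:].
HB.instance Definition _ (I O : finType) := [Finite of allocation I O by <:].

Section Core.

Variables (I O : finType) (E : economy I O).
Implicit Types (C : {set I}) (mu sigma : allocation I O).

Definition wprefers (i : I) (a b : option O) : bool :=
  (a == b) || prefers E i a b.

Definition coalition C : bool := C != set0.

Definition endowment C : {set O} := [set o | owners E o \subset C].

Definition self_enforcing sigma C : bool :=
  sigma @: C \subset None |: (Some @: endowment C).

Definition unchanged mu sigma C : {set I} := [set i in C | sigma i == mu i].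

(* The strict improvement required of some member of C already forces
   sigma != mu. *)
Definition rectification_blocked mu C sigma : bool :=
  [&& coalition C,
      [forall i in C, wprefers i (sigma i) (mu i)],
      [exists j in C, prefers E j (sigma j) (mu j)],
      self_enforcing sigma C
    & [forall C' : {set I},
        [&& coalition C', C' \subset unchanged mu sigma C
          & self_enforcing sigma C'] ==>
        [forall i in C :\: C',
          (sigma i \in Some @: endowment C') ==>
          (sigma i \notin mu @: (~: C))]]].

Definition rectified_core : {set allocation I O} :=
  [set mu | [forall C : {set I}, forall sigma : allocation I O,
     ~~ rectification_blocked mu C sigma]].

End Core.

(* Main.v *)
(* The allocation is built by a variant of top trading cycles.  Let [R] be the
   set of agents served so far and [mu] their assignment.  The hull of an object
   is the smallest set containing its owners and, with each of its served
   members, the owners of what that member received.  Every unserved agent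
   demands its favourite available object.  If the hull of that object contains
   an unserved agent, the demand points to such an agent; otherwise (and if [None]
   is demanded) the agent points to itself and is served at once.  A minimal set
   closed under pointing is a cycle, and it is served next.

   Suppose that [C] blocks via [sigma], and let [i] be the first served member
   of [C] with [sigma i != mu i].  Then [sigma i] is an object that went earlier
   to some [j] outside [C].  Up to that point [sigma = mu] on [C], so the hull
   of any object owned within [C] lies in [C].  If the hull of [sigma i]
   contained an unserved agent, the whole cycle of [j] would lie in [C]; hence
   the hull was entirely served, and it is a self-enforcing coalition of
   unchanged agents that forbids giving [sigma i] to [i]. *)
Require Import Defs.
From mathcomp Require Import all_boot.

Set Implicit Arguments.
Unset Strict Implicit.
Unset Printing Implicit Defensive.

Section TopTradingCycles.

Variables (I O : finType) (E : economy I O).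
Implicit Types (R C S X : {set I}) (mu sigma : I -> option O) (o : O).

(** * Supported sets, hulls and the invariant of a stage *)

Definition option_owners (a : option O) : {set I} :=
  if a is Some o then owners E o else set0.

(** For [C] inside [R] this is self-enforcement of [C] in [mu]. Members outside [R] are ignored,
    since their value under [mu] means nothing yet. *)
Definition supported mu R C : bool :=
  [forall x in C :&: R, option_owners (mu x) \subset C].

Definition hull mu R o : {set I} :=
  \bigcap_(C : {set I} | supported mu R C && (owners E o \subset C)) C.

Definition object_injective mu R : Prop :=
  forall i j o, i \in R -> j \in R -> mu i = Some o -> mu j = Some o -> i = j.

(** Supplies the coalition for condition 3 of blocking: in the construction [X] is the hull of [o]
    in the round that assigns [o]. *)
Definition outsiders_claim_exhausted mu R : Prop :=
  forall C j o, supported mu R C -> j \in R -> j \notin C -> mu j = Some o ->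
    owners E o \subset C ->
  exists X, [/\ X \subset C :&: R, supported mu R X & owners E o \subset X].

(** Absence of blocking, restricted to served agents so that it passes from one round to the next;
    the long premise on [X] is condition 3. *)
Definition unimprovable mu R : Prop :=
  forall C sigma, object_injective sigma C ->
    {in C :&: R, forall i, wprefers E i (sigma i) (mu i)} ->
    supported sigma C C ->
    (forall X i j o, X \subset C :&: R -> supported mu R X ->
      {in X, sigma =1 mu} -> i \in C -> i \notin X -> sigma i = Some o ->
      owners E o \subset X -> j \in R -> j \notin C -> mu j <> Some o) ->
  {in C :&: R, sigma =1 mu}.

Definition stage mu R : Prop :=
  [/\ object_injective mu R, outsiders_claim_exhausted mu R & unimprovable mu R].

Lemma supportedP mu R C :
  reflect (forall x, x \in C -> x \in R -> option_owners (mu x) \subset C)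
          (supported mu R C).
Proof.
apply: (iffP forall_inP) => [H x xC xR|H x /setIP[]]; last exact: H.
by apply: H; rewrite inE xC.
Qed.

Lemma hull_sub mu R C o :
  supported mu R C -> owners E o \subset C -> hull mu R o \subset C.
Proof. by move=> sC oC; apply: bigcap_inf; rewrite sC. Qed.

Lemma owners_sub_hull mu R o : owners E o \subset hull mu R o.
Proof. by apply/bigcapsP => C /andP[]. Qed.

Lemma supported_hull mu R o : supported mu R (hull mu R o).
Proof.
apply/supportedP => x xH xR; apply/bigcapsP => C /andP[sC oC].
by apply: (supportedP _ _ _ sC) => //; apply: (subsetP (hull_sub sC oC)).
Qed.

(** * Favourites and minimal cycles *)

Lemma favourite (i : I) (A : {set option O}) :
  A != set0 -> exists2 a, a \in A & {in A, forall b, ~~ prefers E i b a}.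
Proof.
case/set0Pn=> a0 a0A.
(* A favourite beats the largest number of alternatives. *)
case: (arg_maxnP (fun a => #|[set b | prefers E i a b]|) a0A) => a aA amax.
exists a => // b bA; apply/negP => ba.
have := amax b bA; rewrite /= leqNgt => /negP[]; apply: proper_card.
apply/properP; split.
  by apply/subsetP => c; rewrite !inE; apply: prefers_trans ba.
by exists a; rewrite !inE // prefers_irr.
Qed.

(** The image of a minimal stable set [S] is again stable, so [f @: S = S], and finiteness makes [f]
    injective on [S]. *)
Lemma minimal_stable_set (f : I -> I) (A : {set I}) :
  A != set0 -> f @: A \subset A ->
  exists S, [/\ S != set0, S \subset A, f @: S \subset S, {in S &, injective f}
    & forall B : {set I}, B != set0 -> f @: B \subset B -> B \subset S -> B = S].
Proof.
move=> A0 fA.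
pose P (B : {set I}) := (B != set0) && (f @: B \subset B).
have [S /minsetP[/andP[S0 fS] Smin] SA] :
    {S : {set I} | minset P S & S \subset A}.
  by apply: minset_exists; rewrite /P A0.
have fSE : f @: S = S.
  apply: Smin => //; rewrite /P imsetS // andbT.
  by case/set0Pn: S0 => x xS; apply/set0Pn; exists (f x); apply: imset_f.
exists S; split=> //; first by apply/imset_injP; rewrite fSE.
by move=> B B0 fB BS; apply: Smin => //; rewrite /P B0.
Qed.

(** * One round of trading *)

Section Step.

Variables (mu : I -> option O) (R : {set I}).
Hypotheses (stageR : stage mu R) (R_proper : ~: R != set0).

Definition available : {set option O} :=
  [set a | (a == None) || [forall j in R, mu j != a]].

Lemma favourite_available :
  exists fav : {ffun I -> option O},
    forall i, fav i \in available /\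
      {in available, forall b, ~~ prefers E i b (fav i)}.
Proof.
have A0 : available != set0 by apply/set0Pn; exists None; rewrite inE.
have ex i : exists a,
    (a \in available) && [forall b in available, ~~ prefers E i b a].
  have [a aA amax] := favourite i A0.
  by exists a; rewrite aA; apply/forall_inP.
exists [ffun i => xchoose (ex i)] => i; rewrite ffunE.
by have /andP[aA /forall_inP] := xchooseP (ex i).
Qed.

Definition target (fav : I -> option O) (i : I) : I :=
  if fav i is Some o then odflt i [pick k in hull mu R o :\: R] else i.

Lemma stage_step :
  exists mu' S, [/\ S != set0, S \subset ~: R & stage mu' (R :|: S)].
Proof.
have [injR claimR unimpR] := stageR.
have [fav favP] := favourite_available.
have fav_free i o j : fav i = Some o -> j \in R -> mu j <> Some o.
  move=> fi jR mj; have [] := favP i; rewrite inE fi /= => /forall_inP/(_ j jR).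
  by rewrite mj eqxx.
pose f := target fav.
have fR : f @: (~: R) \subset ~: R.
  apply/subsetP => _ /imsetP[i iR ->]; rewrite /f /target.
  case: (fav i) => [o|] //; case: pickP => [k|_] //=.
  by rewrite !inE => /andP[].
have [S [S0 SR fS injS Smin]] := minimal_stable_set R_proper fR.
pose mu' i := if i \in S then fav i else mu i.
have muS i : i \in S -> mu' i = fav i by rewrite /mu' => ->.
have muR i : i \in R -> mu' i = mu i.
  by rewrite /mu'; case: ifP => // /(subsetP SR); rewrite inE => /negP.
have supR C : supported mu' (R :|: S) C -> supported mu R C.
  move/supportedP => sC; apply/supportedP => x xC xR.
  by rewrite -muR //; apply: sC => //; rewrite inE xR.
have supX X : X \subset R -> supported mu R X -> supported mu' (R :|: S) X.
  move=> XR /supportedP sX; apply/supportedP => x xX _.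
  by have xR := subsetP XR _ xX; rewrite muR //; apply: sX.
have claim : outsiders_claim_exhausted mu' (R :|: S).
  move=> C j o sC; case/setUP=> [jR|jS] jC.
    rewrite muR // => mj oC.
    have [X [XCR sX oX]] := claimR C j o (supR C sC) jR jC mj oC.
    exists X; split=> //; last apply: supX => //.
      by apply: subset_trans XCR _; rewrite setIS // subsetUl.
    exact: subset_trans XCR (subsetIr _ _).
  rewrite muS // => fj oC.
  have HC := hull_sub (supR C sC) oC.
  (* A fully served hull is the required [X]. Otherwise [j] points to an unserved agent of the hull,
     hence into [C]. *)
  have [HR|HnR] := boolP (hull mu R o \subset R).
    exists (hull mu R o); split; last exact: owners_sub_hull.
      by rewrite subsetI HC (subset_trans HR) ?subsetUl.
    by apply: supX => //; apply: supported_hull.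
  have fjC : f j \in C.
    rewrite /f /target fj; case: pickP => [k|none] /=.
      by rewrite inE => /andP[_ /(subsetP HC)].
    by case/negP: HnR; rewrite -setD_eq0; apply/eqP/setP => k; rewrite none inE.
  (* Pointing preserves [S :&: C]: a member of it receives an object owned within [C], whose hull
     stays in [C]. Minimality then puts all of [S], and so [j], in [C]. *)
  case/negP: jC; suff : S :&: C = S by move/setIidPl/subsetP; apply.
  apply: Smin; last exact: subsetIl.
    apply/set0Pn; exists (f j); rewrite inE fjC andbT.
    by apply: (subsetP fS); apply: imset_f.
  apply/subsetP => _ /imsetP[x /setIP[xS xC] ->]; rewrite inE.
  rewrite (subsetP fS) ?imset_f //= /f /target.
  case fx: (fav x) => [p|] //; case: pickP => [k|_] //=.
  rewrite inE => /andP[_]; apply: subsetP; apply: hull_sub; first exact: supR.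
  have := supportedP _ _ _ sC x xC; rewrite muS // fx; apply.
  by rewrite inE xS orbT.
have injRS : object_injective mu' (R :|: S).
  move=> i j o /setUP[iR|iS] /setUP[jR|jS].
  - by rewrite !muR //; apply: injR.
  - by rewrite (muR i) // (muS j) // => mi /fav_free/(_ iR).
  - by rewrite (muS i) // (muR j) // => /fav_free/(_ jR).
  rewrite !muS // => fi fj.
  (* Two agents of [S] with the same favourite point to the same unserved agent, or [i] points to
     itself and is all of [S]. *)
  case: (pickP [in hull mu R o :\: R]) => [k kH|none].
    apply: injS => //; rewrite /f /target fi fj.
    by case: pickP => // /(_ k); rewrite kH.
  have fii : f i = i by rewrite /f /target fi; case: pickP => // k; rewrite none.
  have : [set i] = S.
    by apply: Smin; rewrite ?sub1set // ?imset_set1 ?fii // -card_gt0 cards1.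
  by move/setP/(_ j); rewrite jS inE => /eqP.
exists mu', S; split=> //; split=> // C sigma injC weak supC block.
have eqR : {in C :&: R, sigma =1 mu}.
  apply: unimpR => //.
    move=> i /setIP[iC iR]; rewrite -muR //; apply: weak.
    by rewrite !inE iC iR.
  move=> X i j o XCR sX eqX iC iX si oX jR jC mj.
  have [XC XR] := subsetIP XCR.
  apply: (block X i j o) => //.
  - by rewrite subsetI XC (subset_trans XR) ?subsetUl.
  - exact: supX.
  - by move=> x xX; rewrite muR ?eqX //; apply: (subsetP XR).
  - by rewrite inE jR.
  - by rewrite muR.
move=> i /setIP[iC iRS].
have [iR|iNR] := boolP (i \in R); first by rewrite muR // eqR // inE iC.
have iS : i \in S by move: iRS; rewrite inE (negPf iNR).
have := weak i; rewrite inE iC iRS => /(_ isT) /orP[/eqP //|].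
rewrite muS // => better; exfalso.
have [_ best] := favP i.
(* Only an object taken in an earlier round can beat the favourite. *)
have : sigma i \notin available by apply/negP => /best; rewrite better.
rewrite inE negb_or negb_forall_in => /andP[]; case si: (sigma i) => [o|] // _.
case/exists_inP=> j jR; rewrite negbK => /eqP mj.
(* Otherwise [sigma] would give [o] to both [i] and [j]. *)
have jC : j \notin C.
  apply/negP => jC; have sj : sigma j = Some o by rewrite eqR // inE jC.
  by move: iNR; rewrite (injC i j o) // jR.
have sCR : supported mu R C.
  apply/supportedP => x xC xR; rewrite -eqR ?inE ?xC //.
  exact: (supportedP _ _ _ supC).
have oC : owners E o \subset C.
  by have := supportedP _ _ _ supC i iC iC; rewrite si.
have [X [XCR sX oX]] := claimR C j o sCR jR jC mj oC.
have [XC XR] := subsetIP XCR.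
apply: (block X i j o) => //.
- by rewrite subsetI XC (subset_trans XR) ?subsetUl.
- exact: supX.
- move=> x xX; rewrite muR ?eqR //; first exact: (subsetP XCR).
  exact: (subsetP XR).
- by apply: contra iNR => /(subsetP XR).
- by rewrite inE jR.
- by rewrite muR.
Qed.

End Step.

(** * Serving all agents *)

Lemma stage_complete : exists mu, stage mu setT.
Proof.
suff H n mu R : #|~: R| <= n -> stage mu R -> exists mu', stage mu' setT.
  (* With nobody served the invariant is vacuous, so any initial assignment would do. *)
  apply: (H #|I| (fun=> None) set0) => //; first exact: max_card.
  split=> [i j o|C j o _|C sigma _ _ _ _ i]; by rewrite !inE // ?andbF.
elim: n mu R => [|n IHn] mu R.
  rewrite leqn0 cards_eq0 => /eqP R0 stR; exists mu.
  by rewrite -[setT]setC0 -R0 setCK.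
move=> leR stR; have [R0|Rp] := eqVneq (~: R) set0.
  by exists mu; rewrite -[setT]setC0 -R0 setCK.
have [mu' [S [S0 SR stS]]] := stage_step stR Rp.
apply: IHn stS; rewrite -ltnS; apply: leq_trans leR; apply: proper_card.
case/set0Pn: S0 => x xS; apply/properP; split.
  by rewrite setCS subsetUl.
exists x; first exact: (subsetP SR).
by rewrite !inE xS orbT.
Qed.

(** * From the invariant to the rectified core *)

Lemma self_enforcingE (sigma : allocation I O) C :
  self_enforcing E sigma C = supported sigma C C.
Proof.
apply/subsetP/supportedP => [H x xC _|H _ /imsetP[x xC ->]].
  have := H _ (imset_f _ xC); rewrite !inE; case: (sigma x) => [o|] /=.
    by case/imsetP=> p; rewrite inE => oC [->].
  by rewrite sub0set.
rewrite !inE; have := H x xC xC; case: (sigma x) => [o|] //= oC.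
by apply/imsetP; exists o; rewrite ?inE.
Qed.

Lemma allocation_injective (sigma : allocation I O) C :
  object_injective sigma C.
Proof.
move=> i j o _ _ si sj; have /forallP/(_ o)/card_le1_eqP := allocP sigma.
by apply; rewrite inE ?si ?sj eqxx.
Qed.

Lemma injective_is_allocation mu :
  object_injective mu setT -> is_allocation [ffun i => mu i].
Proof.
move=> inj; apply/forallP => o; apply/card_le1_eqP => i j.
by rewrite !inE !ffunE => /eqP mi /eqP mj; apply: (inj j i o); rewrite ?inE.
Qed.

Lemma unimprovable_rectified_core (mu : allocation I O) :
  unimprovable mu setT -> mu \in rectified_core E.
Proof.
move=> unimp; rewrite inE; apply/forallP => C; apply/forallP => sigma.
apply/negP => /and5P[_ /forall_inP weak /exists_inP[j jC better]].
rewrite self_enforcingE => supC /forallP rectify.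
have eqC : {in C :&: setT, sigma =1 mu}.
  apply: unimp => //; first exact: allocation_injective.
    by move=> i; rewrite setIT; apply: weak.
  move=> X i k o; rewrite setIT => XC sX eqX iC iX si oX _ kC mk.
  have /implyP H := rectify X.
  have /H /forall_inP/(_ i) : [&& coalition X, X \subset unchanged mu sigma C
      & self_enforcing E sigma X].
    apply/and3P; split.
    (* [X] is nonempty because it contains the owners of [o]. *)
    - apply: contraNneq (owners_neq0 E o) => X0.
      by rewrite -subset0 -X0.
    - apply/subsetP => x xX; rewrite inE (subsetP XC) //=.
      by apply/eqP/eqX.
    - rewrite self_enforcingE; apply/supportedP => x xX _; rewrite eqX //.
      by apply: (supportedP _ _ _ sX); rewrite ?inE.
  rewrite inE iX iC => /(_ isT) /implyP; rewrite si => /(_ _)/negP[].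
    by apply: imset_f; rewrite inE.
  by rewrite -mk; apply: imset_f; rewrite inE.
by move: better; rewrite eqC ?setIT // prefers_irr.
Qed.

End TopTradingCycles.

Theorem theorem1 (I O : finType) (E : economy I O) : rectified_core E != set0.
Proof.
have [mu [inj _ unimp]] := stage_complete E.
apply/set0Pn; exists (Allocation (injective_is_allocation inj)).
apply: unimprovable_rectified_core => C sigma injC weak supC block i iC.
rewrite /= ffunE; apply: (unimp C sigma) => //.
  by move=> k /weak; rewrite /= ffunE.
move=> X k j o XC sX eqX kC kX sk oX jT jC mj.
apply: (block X k j o) => //; last by rewrite /= ffunE.
  apply/supportedP => x xX xT; rewrite /= ffunE.
  by move/supportedP: sX; apply.
by move=> x xX; rewrite /= ffunE eqX.
Qed.
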